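(* Let $K$ be a field, let $\mathcal O$ be an operad in $Vect_K$, let $C$ be a $K$-coalgebra and let $\mathscr A$ be an $\mathcal O$-algebra. (a) There is an $\mathcal O$-algebra $C\rhd\mathscr A$ (the Sweedler product) and a measuring $\phi(C,\mathscr A):C\longrightarrow \mathrm{Hom}_K(\mathscr A,C\rhd\mathscr A)$ of $\mathcal O$-algebras with the following universal property: given any measuring $\phi':C\longrightarrow \mathrm{Hom}_K(\mathscr A,\mathscr B)$ of $\mathcal O$-algebras, there exists a unique morphism $f:C\rhd\mathscr A\longrightarrow\mathscr B$ of $\mathcal O$-algebras such that $\phi'=\mathrm{Hom}(\mathscr A,f)\circ\phi(C,\mathscr A)$. (b) Suppose that $C$ is cocommutative. For $\mathcal O$-algebras $\mathscr A$, $\mathscr B$, there are natural isomorphisms $$Alg_{\mathcal O}(C\rhd\mathscr A,\mathscr B)\cong Alg_{\mathcal O}(\mathscr A,[C,\mathscr B]).$$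
   Context: Operads are symmetric unital operads in $K$-vector spaces (left $K[S_n]$-modules $\mathcal O(n)$, $n\ge0$, compositions, unit, usual axioms). An $\mathcal O$-algebra is a vector space $\mathscr A$ with maps $\mathcal O(n)\otimes\mathscr A^{\otimes n}\to\mathscr A$ ($n\ge0$), written $\theta(a_1,\ldots,a_n)$, with the usual associativity, equivariance and unitality axioms; for $n=0$ write $u_{\mathscr A}:\mathcal O(0)\to\mathscr A$. $Alg_{\mathcal O}$ is the category of $\mathcal O$-algebras, and $Alg_{\mathcal O}(-,-)$ its Hom-sets. Coalgebras $(C,\Delta,\epsilon)$ are coassociative and counital, $\Delta^{n-1}(c)=\sum c_1\otimes\cdots\otimes c_n$. A measuring of $\mathcal O$-algebras from $\mathscr A$ to $\mathscr B$ is a linear map $\phi:C\to \mathrm{Hom}_K(\mathscr A,\mathscr B)$ with $\phi(c)(\theta(a_1,\ldots,a_n))=\sum\theta(\phi(c_1)(a_1),\ldots,\phi(c_n)(a_n))$ for $\theta\in\mathcal O(n)$, $n\ge1$, and $\phi(c)(u_{\mathscr A}(\theta_0))=\epsilon(c)u_{\mathscr B}(\theta_0)$ for $\theta_0\in\mathcal O(0)$. Construction of $C\rhd\mathscr A$: let $\mathscr F(C\otimes\mathscr A)$ be the free $\mathcal O$-algebra on the vector space $C\otimes\mathscr A$, and write $c\rhd a$ for the image of $c\otimes a$ under the canonical map $C\otimes\mathscr A\to\mathscr F(C\otimes\mathscr A)$. An ideal of an $\mathcal O$-algebra $\mathscr B$ is a subspace $\mathscr I$ with $\theta(b_1,\ldots,b_{n-1},x)\in\mathscr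 I$ for all $\theta\in\mathcal O(n)$, $n\geq 1$, $b_i\in\mathscr B$, $x\in\mathscr I$. Let $\mathscr J$ be the smallest ideal containing all elements $c\rhd u_{\mathscr A}(\theta_0)-\epsilon(c)u_{\mathscr F(C\otimes\mathscr A)}(\theta_0)$ and $c\rhd\theta(a_1,\ldots,a_n)-\sum\theta(c_1\rhd a_1,\ldots,c_n\rhd a_n)$ for $c\in C$, $a_i\in\mathscr A$, $\theta_0\in\mathcal O(0)$, $\theta\in\mathcal O(n)$, $n\ge1$. Then $C\rhd\mathscr A:=\mathscr F(C\otimes\mathscr A)/\mathscr J$, and $\phi(C,\mathscr A)(c)(a)$ is the class of $c\rhd a$. For $C$ cocommutative, $[C,\mathscr B]$ is the space $\mathrm{Hom}_K(C,\mathscr B)$ of linear maps with the $\mathcal O$-algebra structure $\theta(f_1,\ldots,f_n)(c)=\sum\theta(f_1(c_1),\ldots,f_n(c_n))$ for $\theta\in\mathcal O(n)$, $n\ge1$, and $u_{[C,\mathscr B]}(\theta_0)(c)=\epsilon(c)u_{\mathscr B}(\theta_0)$ for $\theta_0\in\mathcal O(0)$. *)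

(* Defs.v *)
From HB Require Import structures.
From mathcomp Require Import all_boot all_order all_fingroup all_algebra.
From mathcomp Require Import boolp classical_sets.

Set Implicit Arguments.
Unset Strict Implicit.
Unset Printing Implicit Defensive.

Import GRing.Theory.
Local Open Scope ring_scope.
Local Open Scope quotient_scope.

(* A vector space given by a carrier type with operations satisfying the       *)
(* axioms up to a congruence; vquot below is the quotient space.               *)
Record vect_pres (K : fieldType) := VectPres {
  vp_type :> Type;
  vp_rel : vp_type -> vp_type -> Prop;
  vp_zero : vp_type;
  vp_opp : vp_type -> vp_type;
  vp_add : vp_type -> vp_type -> vp_type;
  vp_scale : K -> vp_type -> vp_type;
  vp_refl : forall x, vp_rel x x;
  vp_sym : forall x y, vp_rel x y -> vp_rel y x;
  vp_trans : forall x y z, vp_rel x y -> vp_rel y z -> vp_rel x z;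
  vp_opp_rel : forall x y, vp_rel x y -> vp_rel (vp_opp x) (vp_opp y);
  vp_add_rel : forall x x' y y',
    vp_rel x x' -> vp_rel y y' -> vp_rel (vp_add x y) (vp_add x' y');
  vp_scale_rel : forall a x y,
    vp_rel x y -> vp_rel (vp_scale a x) (vp_scale a y);
  vp_addA : forall x y z,
    vp_rel (vp_add x (vp_add y z)) (vp_add (vp_add x y) z);
  vp_addC : forall x y, vp_rel (vp_add x y) (vp_add y x);
  vp_add0 : forall x, vp_rel (vp_add vp_zero x) x;
  vp_addN : forall x, vp_rel (vp_add (vp_opp x) x) vp_zero;
  vp_scaleA : forall a b x,
    vp_rel (vp_scale a (vp_scale b x)) (vp_scale (a * b) x);
  vp_scale1 : forall x, vp_rel (vp_scale 1 x) x;
  vp_scaleDr : forall a x y, vp_rel (vp_scale a (vp_add x y))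
    (vp_add (vp_scale a x) (vp_scale a y));
  vp_scaleDl : forall a b x, vp_rel (vp_scale (a + b) x)
    (vp_add (vp_scale a x) (vp_scale b x)) }.

Section VectPresQuotient.
Variables (K : fieldType) (P : vect_pres K).

Definition vp_car : Type := P.
HB.instance Definition _ := gen_eqMixin vp_car.
HB.instance Definition _ := gen_choiceMixin vp_car.

Definition vp_eqv (x y : vp_car) : bool := `[< vp_rel x y >].

Lemma vp_eqv_equiv : equiv_class_of vp_eqv.
Proof.
split=> [x|x y|y x z]; first exact/asboolP/vp_refl.
  by apply/asboolP/asboolP; apply: vp_sym.
by move=> /asboolP xy /asboolP yz; apply/asboolP; apply: vp_trans xy yz.
Qed.
Canonical vp_eqv_rel := EquivRelPack vp_eqv_equiv.

Definition vquot := {eq_quot vp_eqv_rel}.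
HB.instance Definition _ := Choice.on vquot.
HB.instance Definition _ := EqQuotient.on vquot.

Definition vq_pi (x : P) : vquot := \pi_vquot (x : vp_car).
Definition vq_repr (x : vquot) : P := generic_quotient.repr x.

Lemma vq_piE (x y : P) : vq_pi x = vq_pi y <-> vp_rel x y.
Proof.
split=> [/eqP|xy]; first by rewrite /vq_pi eqmodE => /asboolP.
by apply/eqP; rewrite /vq_pi eqmodE; apply/asboolP.
Qed.

Lemma vq_reprK x : vq_pi (vq_repr x) = x.
Proof. exact: reprK. Qed.

Lemma vq_repr_pi (x : P) : vp_rel (vq_repr (vq_pi x)) x.
Proof. by apply/vq_piE; rewrite vq_reprK. Qed.

Definition vq_zero : vquot := vq_pi (vp_zero P).
Definition vq_opp (x : vquot) : vquot := vq_pi (vp_opp (vq_repr x)).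
Definition vq_add (x y : vquot) : vquot := vq_pi (vp_add (vq_repr x) (vq_repr y)).
Definition vq_scale (a : K) (x : vquot) : vquot := vq_pi (vp_scale a (vq_repr x)).

Lemma vq_oppE x : vq_opp (vq_pi x) = vq_pi (vp_opp x).
Proof. exact/vq_piE/vp_opp_rel/vq_repr_pi. Qed.
Lemma vq_addE x y : vq_add (vq_pi x) (vq_pi y) = vq_pi (vp_add x y).
Proof. by apply/vq_piE/vp_add_rel; apply: vq_repr_pi. Qed.
Lemma vq_scaleE a x : vq_scale a (vq_pi x) = vq_pi (vp_scale a x).
Proof. exact/vq_piE/vp_scale_rel/vq_repr_pi. Qed.

Fact vq_addA : associative vq_add.
Proof.
move=> x y z; rewrite -(vq_reprK x) -(vq_reprK y) -(vq_reprK z) !vq_addE.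
exact/vq_piE/vp_addA.
Qed.
Fact vq_addC : commutative vq_add.
Proof. by move=> x y; apply/vq_piE/vp_addC. Qed.
Fact vq_add0 : left_id vq_zero vq_add.
Proof. by move=> x; rewrite -(vq_reprK x) vq_addE; apply/vq_piE/vp_add0. Qed.
Fact vq_addN : left_inverse vq_zero vq_opp vq_add.
Proof. by move=> x; rewrite -(vq_reprK x) vq_oppE vq_addE; apply/vq_piE/vp_addN. Qed.
HB.instance Definition _ :=
  GRing.isZmodule.Build vquot vq_addA vq_addC vq_add0 vq_addN.

Fact vq_scaleA a b x : vq_scale a (vq_scale b x) = vq_scale (a * b) x.
Proof. by rewrite -(vq_reprK x) !vq_scaleE; apply/vq_piE/vp_scaleA. Qed.
Fact vq_scale1 : left_id 1 vq_scale.
Proof. by move=> x; rewrite -(vq_reprK x) vq_scaleE; apply/vq_piE/vp_scale1. Qed.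
Fact vq_scaleDr : right_distributive vq_scale +%R.
Proof.
move=> a x y; rewrite -(vq_reprK x) -(vq_reprK y) /GRing.add/= vq_addE !vq_scaleE.
by rewrite vq_addE; apply/vq_piE/vp_scaleDr.
Qed.
Fact vq_scaleDl x : {morph vq_scale^~ x : a b / a + b}.
Proof.
move=> a b; rewrite -(vq_reprK x) /GRing.add/= !vq_scaleE vq_addE.
exact/vq_piE/vp_scaleDl.
Qed.
HB.instance Definition _ := GRing.Zmodule_isLmodule.Build K vquot
  vq_scaleA vq_scale1 vq_scaleDr vq_scaleDl.

Lemma vq_pi0 : vq_pi (vp_zero P) = 0. Proof. by []. Qed.
Lemma vq_piD x y : vq_pi (vp_add x y) = vq_pi x + vq_pi y.
Proof. by rewrite -vq_addE. Qed.
Lemma vq_piN x : vq_pi (vp_opp x) = - vq_pi x.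
Proof. by rewrite -vq_oppE. Qed.
Lemma vq_piZ a x : vq_pi (vp_scale a x) = a *: vq_pi x.
Proof. by rewrite -vq_scaleE. Qed.

End VectPresQuotient.

Notation bilinear f := (bilinear_for *:%R *:%R f).

Section Tensor.
Variables (K : fieldType) (V W : lmodType K).

Definition tsum (Z : lmodType K) (f : V -> W -> Z) (s : seq (V * W)) : Z :=
  \sum_(p <- s) f p.1 p.2.

(* Formal sums of pairs, identified when no bilinear map separates them. The   *)
(* universal property is tlift_linear, tlift_tens and tlift_id.                *)
Definition trel (s t : seq (V * W)) : Prop :=
  forall (Z : lmodType K) (f : V -> W -> Z), bilinear f -> tsum f s = tsum f t.

Definition tscale (a : K) (s : seq (V * W)) := [seq (a *: p.1, p.2) | p <- s].

Lemma tsum_nil (Z : lmodType K) (f : V -> W -> Z) : tsum f [::] = 0.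
Proof. by rewrite /tsum big_nil. Qed.
Lemma tsum_cat (Z : lmodType K) (f : V -> W -> Z) s t :
  tsum f (s ++ t) = tsum f s + tsum f t.
Proof. by rewrite /tsum big_cat. Qed.
Lemma tsum_scale (Z : lmodType K) (f : V -> W -> Z) a s : bilinear f ->
  tsum f (tscale a s) = a *: tsum f s.
Proof.
move=> [fl _]; rewrite /tsum big_map scaler_sumr; apply: eq_bigr => -[x y] _ /=.
exact: (scalable_linear (fl y)).
Qed.

Definition tensor_pres : vect_pres K.
Proof.
refine (@VectPres K (seq (V * W)) trel [::] (tscale (-1)) cat tscale
          _ _ _ _ _ _ _ _ _ _ _ _ _ _) => //.
- by move=> s t e Z f bf; rewrite e.
- by move=> s t u e e' Z f bf; rewrite e ?e'.
- by move=> s t e Z f bf; rewrite !tsum_scale ?e.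
- by move=> s s' t t' e e' Z f bf; rewrite !tsum_cat e ?e'.
- by move=> a s t e Z f bf; rewrite !tsum_scale ?e.
- by move=> s t u Z f bf; rewrite !tsum_cat addrA.
- by move=> s t Z f bf; rewrite !tsum_cat addrC.
- by move=> s Z f bf; rewrite tsum_cat tsum_scale // scaleN1r addNr tsum_nil.
- by move=> a b s Z f bf; rewrite !tsum_scale // scalerA.
- by move=> s Z f bf; rewrite tsum_scale // scale1r.
- by move=> a s t Z f bf; rewrite !(tsum_cat, tsum_scale) // scalerDr.
- by move=> a b s Z f bf; rewrite !(tsum_cat, tsum_scale) // scalerDl.
Defined.

Definition tensor : lmodType K := vquot tensor_pres.

Definition tens (x : V) (y : W) : tensor := vq_pi (P := tensor_pres) [:: (x, y)].

(* For bilinear f this is the linear map induced by f; in Sweedler notation   *)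
(* tlift f (Delta c) = sum f(c_1, c_2).                                       *)
Definition tlift (Z : lmodType K) (f : V -> W -> Z) (t : tensor) : Z :=
  tsum f (vq_repr t).

Lemma tlift_pi (Z : lmodType K) (f : V -> W -> Z) (s : seq (V * W)) :
  bilinear f -> tlift f (vq_pi (P := tensor_pres) s) = tsum f s.
Proof. by move=> bf; apply: (vq_repr_pi (P := tensor_pres) s). Qed.

Lemma tlift_tens (Z : lmodType K) (f : V -> W -> Z) x y :
  bilinear f -> tlift f (tens x y) = f x y.
Proof. by move=> bf; rewrite tlift_pi // /tsum big_seq1. Qed.

Lemma tlift_linear (Z : lmodType K) (f : V -> W -> Z) :
  bilinear f -> linear (tlift f).
Proof.
move=> bf a s t; rewrite -(vq_reprK s) -(vq_reprK t) -vq_piZ -vq_piD.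
by rewrite !tlift_pi // tsum_cat tsum_scale.
Qed.

Lemma tensP (s t : tensor) :
  (forall (Z : lmodType K) (f : V -> W -> Z), bilinear f -> tlift f s = tlift f t) ->
  s = t.
Proof.
by move=> e; rewrite -(vq_reprK s) -(vq_reprK t); apply/vq_piE => Z f /e.
Qed.

Lemma tens_bilinear : bilinear tens.
Proof.
split=> [y a x x'|x a y y']; apply: tensP => Z f bf;
  rewrite tlift_linear // !tlift_tens //; first exact: bf.1.
exact: bf.2.
Qed.

Lemma tlift_comp (Z Z' : lmodType K) (L : Z -> Z') (f : V -> W -> Z) t :
  linear L -> L (tlift f t) = tlift (fun x y => L (f x y)) t.
Proof.
move=> lL; pose LL := GRing.isLinear.Build K Z Z' *:%R L lL.
pose L' : {linear Z -> Z'} := HB.pack L LL.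
by rewrite -[L]/(L' : _ -> _) linear_sum.
Qed.

Lemma tlift_id (t : tensor) : tlift tens t = t.
Proof.
apply: tensP => Z f bf; rewrite (tlift_comp _ _ (tlift_linear bf)).
by apply: eq_bigr => p _; rewrite tlift_tens.
Qed.

Lemma eq_tlift (Z : lmodType K) (f g : V -> W -> Z) t :
  (forall x y, f x y = g x y) -> tlift f t = tlift g t.
Proof. by move=> fg; apply: eq_bigr => p _. Qed.

End Tensor.

Arguments tens {K V W} x y.

Section LinHom.
Variables (K : fieldType) (V W : lmodType K).

Lemma linear_funP (f g : {linear V -> W}) : f =1 g -> f = g.
Proof.
case: f g => f [[f1] [f2]] [g [[g1] [g2]]] /= /funext fg.
by subst g; rewrite (Prop_irrelevance f1 g1) (Prop_irrelevance f2 g2).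
Qed.

Definition mk_linear (f : V -> W) (lf : linear f) : {linear V -> W} :=
  HB.pack f (GRing.isLinear.Build K V W *:%R f lf).

Lemma mk_linearE f (lf : linear f) : mk_linear lf = f :> (V -> W).
Proof. by []. Qed.

Definition linhom : Type := {linear V -> W}.
HB.instance Definition _ := gen_eqMixin linhom.
HB.instance Definition _ := gen_choiceMixin linhom.

Definition lh_fun (f : linhom) : {linear V -> W} := f.
Coercion lh_fun : linhom >-> GRing.Linear.type.

Definition lh_zero : linhom := (\0 : {linear V -> W}).
Definition lh_opp (f : linhom) : linhom := (\- lh_fun f : {linear V -> W}).
Definition lh_add (f g : linhom) : linhom := (lh_fun f \+ lh_fun g : {linear V -> W}).
Definition lh_scale (a : K) (f : linhom) : linhom := (a \*: lh_fun f : {linear V -> W}).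

Fact lh_addA : associative lh_add.
Proof. by move=> f g h; apply: linear_funP => x; apply: addrA. Qed.
Fact lh_addC : commutative lh_add.
Proof. by move=> f g; apply: linear_funP => x; apply: addrC. Qed.
Fact lh_add0 : left_id lh_zero lh_add.
Proof. by move=> f; apply: linear_funP => x; apply: add0r. Qed.
Fact lh_addN : left_inverse lh_zero lh_opp lh_add.
Proof. by move=> f; apply: linear_funP => x; apply: addNr. Qed.
HB.instance Definition _ :=
  GRing.isZmodule.Build linhom lh_addA lh_addC lh_add0 lh_addN.

Fact lh_scaleA a b f : lh_scale a (lh_scale b f) = lh_scale (a * b) f.
Proof. by apply: linear_funP => x; apply: scalerA. Qed.
Fact lh_scale1 : left_id 1 lh_scale.
Proof. by move=> f; apply: linear_funP => x; apply: scale1r. Qed.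
Fact lh_scaleDr : right_distributive lh_scale +%R.
Proof. by move=> a f g; apply: linear_funP => x; apply: scalerDr. Qed.
Fact lh_scaleDl f : {morph lh_scale^~ f : a b / a + b}.
Proof. by move=> a b; apply: linear_funP => x; apply: scalerDl. Qed.
HB.instance Definition _ := GRing.Zmodule_isLmodule.Build K linhom
  lh_scaleA lh_scale1 lh_scaleDr lh_scaleDl.

Lemma lh_lincomb a (f g : linhom) x : (a *: f + g) x = a *: f x + g x.
Proof. by []. Qed.

End LinHom.

Definition multilinear (K : fieldType) (n : nat) (V : 'I_n -> lmodType K)
    (W : lmodType K) (f : (forall i, V i) -> W) : Prop :=
  forall (v : forall i, V i) (i : 'I_n), linear (fun x : V i => f (dfwith v x)).

Lemma dfwith_map (n : nat) (T U : 'I_n -> Type) (F : forall j, T j -> U j)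
    (v : forall j, T j) (i : 'I_n) (x : T i) :
  (fun j => F j (dfwith v x j)) = dfwith (fun j => F j (v j)) (F i x).
Proof.
apply/functional_extensionality_dep => j; case: (dfwithP v x) => [|j' ij].
  by rewrite dfwith_in.
by rewrite (dfwith_out _ _ ij).
Qed.

(* For h : 'I_m -> 'I_n bijective, y is the operation obtained from x by      *)
(* relabelling inputs along h, i.e. y(a_1, ..., a_n) = x(a_(h 1), ..., a_(h m)). *)
Definition relabels (O : nat -> Type) (act : forall n, 'S_n -> O n -> O n)
    (m n : nat) (h : 'I_m -> 'I_n) (x : O m) (y : O n) : Prop :=
  exists (e : m = n) (s : 'S_n),
    (forall i, s (cast_ord e i) = h i) /\ y = act n s (ecast k (O k) e x).

Arguments tagnat.Rank {n p_} i j.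

(* The renumberings of inputs occurring in the operad axioms; tagnat.Rank i j *)
(* is the j-th element of the i-th block of 'I_(\sum_i k i), and sig1, sig2   *)
(* are the inverse maps.                                                      *)

Definition assoc_map n (k : 'I_n -> nat) (l : 'I_(\sum_i k i)%N -> nat)
    (u : 'I_(\sum_i \sum_(j < k i) l (tagnat.Rank i j))%N) : 'I_(\sum_p l p)%N :=
  let i := tagnat.sig1 u in
  let v : 'I_(\sum_(j < k i) l (tagnat.Rank i j))%N := tagnat.sig2 u in
  tagnat.Rank (tagnat.Rank i (tagnat.sig1 v)) (tagnat.sig2 v).

Definition block_perm n (k : 'I_n -> nat) (s : 'S_n)
    (u : 'I_(\sum_i k (s i))%N) : 'I_(\sum_i k i)%N :=
  tagnat.Rank (s (tagnat.sig1 u)) (tagnat.sig2 u).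

Definition sum_perm n (k : 'I_n -> nat) (s : forall i, 'S_(k i))
    (u : 'I_(\sum_i k i)%N) : 'I_(\sum_i k i)%N :=
  tagnat.Rank (tagnat.sig1 u) (s (tagnat.sig1 u) (tagnat.sig2 u)).

(* The left action is (s x)(a_1, ..., a_n) = x(a_(s 1), ..., a_(s n)) on      *)
(* operations; recall that (t * s)%g is the composite of t followed by s.     *)
Record operad (K : fieldType) := Operad {
  op_space :> nat -> lmodType K;
  op_perm : forall n, 'S_n -> op_space n -> op_space n;
  op_id : op_space 1;
  op_comp : forall n (k : 'I_n -> nat),
    op_space n -> (forall i, op_space (k i)) -> op_space (\sum_i k i)%N;
  op_perm_linear : forall n (s : 'S_n), linear (op_perm s);
  op_perm1 : forall n (x : op_space n), op_perm 1%g x = x;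
  op_permM : forall n (s t : 'S_n) (x : op_space n),
    op_perm (t * s)%g x = op_perm s (op_perm t x);
  op_comp_linear : forall n (k : 'I_n -> nat) (y : forall i, op_space (k i)),
    linear (fun x => op_comp x y);
  op_comp_multilinear : forall n (k : 'I_n -> nat) (x : op_space n),
    multilinear (fun y : forall i, op_space (k i) => op_comp x y);
  op_comp1x : forall n (x : op_space n),
    relabels op_perm (@tagnat.sig2 1 (fun=> n))
      (op_comp op_id (fun _ : 'I_1 => x)) x;
  op_compx1 : forall n (x : op_space n),
    relabels op_perm (@tagnat.sig1 n (fun=> 1%N))
      (op_comp x (fun _ : 'I_n => op_id)) x;
  op_compA : forall n (k : 'I_n -> nat) (l : 'I_(\sum_i k i)%N -> nat)
      (x : op_space n) (y : forall i, op_space (k i)) (z : forall p, op_space (l p)),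
    relabels op_perm (@assoc_map n k l)
      (op_comp x (fun i => op_comp (y i) (fun j => z (tagnat.Rank i j))))
      (op_comp (op_comp x y) z);
  op_comp_perml : forall n (k : 'I_n -> nat) (s : 'S_n)
      (x : op_space n) (y : forall i, op_space (k i)),
    relabels op_perm (@block_perm n k s)
      (op_comp x (fun i => y (s i))) (op_comp (op_perm s x) y);
  op_comp_permr : forall n (k : 'I_n -> nat) (s : forall i, 'S_(k i))
      (x : op_space n) (y : forall i, op_space (k i)),
    relabels op_perm (sum_perm s)
      (op_comp x y) (op_comp x (fun i => op_perm (s i) (y i))) }.

Arguments op_perm {K o n} s x.
Arguments op_id {K o}.
Arguments op_comp {K o n k} x y.

Record algebra (K : fieldType) (O : operad K) := Algebra {
  alg_space :> lmodType K;
  alg_op : forall n, O n -> ('I_n -> alg_space) -> alg_space;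
  alg_op_linear : forall n (a : 'I_n -> alg_space), linear (fun x => alg_op x a);
  alg_op_multilinear : forall n (x : O n), multilinear (alg_op x);
  alg_op_id : forall a, alg_op op_id a = a ord0;
  alg_op_comp : forall n (k : 'I_n -> nat) (x : O n) (y : forall i, O (k i)) a,
    alg_op (op_comp x y) a
      = alg_op x (fun i => alg_op (y i) (fun j => a (tagnat.Rank i j)));
  alg_op_perm : forall n (s : 'S_n) (x : O n) a,
    alg_op (op_perm s x) a = alg_op x (fun i => a (s i)) }.

Arguments alg_op {K O A n} x _ : rename.

Definition alg_unit (K : fieldType) (O : operad K) (A : algebra O) (x : O 0) : A :=
  alg_op x (fun=> 0).

Record alg_hom (K : fieldType) (O : operad K) (A B : algebra O) := AlgHom {
  hom_fun :> {linear A -> B};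
  hom_op : forall n (x : O n) (a : 'I_n -> A),
    hom_fun (alg_op x a) = alg_op x (fun i => hom_fun (a i)) }.

Section AlgHom.
Variables (K : fieldType) (O : operad K).

Lemma alg_homP (A B : algebra O) (f g : alg_hom A B) : f =1 g -> f = g.
Proof.
case: f g => f fP [g gP] /= /linear_funP fg; subst g.
by rewrite (Prop_irrelevance fP gP).
Qed.

Definition hom_comp (A B D : algebra O) (g : alg_hom B D) (f : alg_hom A B) :
  alg_hom A D.
Proof.
exists (mk_linear (linearPZ (g \o f : {linear A -> D}))) => n x a /=.
by rewrite !hom_op.
Defined.

End AlgHom.

Section FreeAlgebra.
Variables (K : fieldType) (O : operad K) (V : lmodType K).

Inductive oterm : Type :=
| OVar of V
| OZero
| OAdd of oterm & oterm
| OScale of K & oterm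
| OOp n of O n & ('I_n -> oterm).

Fixpoint oeval (A : algebra O) (g : V -> A) (t : oterm) : A :=
  match t with
  | OVar v => g v
  | OZero => 0
  | OAdd t u => oeval g t + oeval g u
  | OScale a t => a *: oeval g t
  | OOp _ x ts => alg_op x (fun i => oeval g (ts i))
  end.

(* Terms are identified when they agree under every linear interpretation of  *)
(* V in an O-algebra; see free_algP for the universal property.               *)
Definition oterm_rel (t u : oterm) : Prop :=
  forall (A : algebra O) (g : {linear V -> A}), oeval g t = oeval g u.

Definition free_pres : vect_pres K.
Proof.
refine (@VectPres K oterm oterm_rel OZero (OScale (-1)) OAdd OScale
          _ _ _ _ _ _ _ _ _ _ _ _ _ _) => //.
- by move=> s t e A g; rewrite e.
- by move=> s t u e e' A g; rewrite e e'.
- by move=> s t e A g /=; rewrite e.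
- by move=> s s' t t' e e' A g /=; rewrite e e'.
- by move=> a s t e A g /=; rewrite e.
- by move=> s t u A g /=; rewrite addrA.
- by move=> s t A g /=; rewrite addrC.
- by move=> s A g /=; rewrite add0r.
- by move=> s A g /=; rewrite scaleN1r addNr.
- by move=> a b s A g /=; rewrite scalerA.
- by move=> s A g /=; rewrite scale1r.
- by move=> a s t A g /=; rewrite scalerDr.
- by move=> a b s A g /=; rewrite scalerDl.
Defined.

Definition free_space : lmodType K := vquot free_pres.

Definition free_op n (x : O n) (a : 'I_n -> free_space) : free_space :=
  vq_pi (P := free_pres) (OOp x (fun i => vq_repr (a i))).

Definition free_eval (A : algebra O) (g : {linear V -> A}) (a : free_space) : A :=
  oeval g (vq_repr a).

Lemma free_eval_pi (A : algebra O) (g : {linear V -> A}) (t : oterm) :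
  free_eval g (vq_pi (P := free_pres) t) = oeval g t.
Proof. exact: (vq_repr_pi (P := free_pres) t). Qed.

Lemma free_eval_linear (A : algebra O) (g : {linear V -> A}) : linear (free_eval g).
Proof.
move=> a x y; rewrite -(vq_reprK x) -(vq_reprK y) -vq_piZ -vq_piD.
by rewrite !free_eval_pi.
Qed.

Lemma free_eval_op (A : algebra O) (g : {linear V -> A}) n (x : O n) a :
  free_eval g (free_op x a) = alg_op x (fun i => free_eval g (a i)).
Proof. by rewrite free_eval_pi. Qed.

Lemma free_eqP (a b : free_space) :
  (forall (A : algebra O) (g : {linear V -> A}), free_eval g a = free_eval g b) -> a = b.
Proof.
by move=> e; rewrite -(vq_reprK a) -(vq_reprK b); apply/vq_piE => A g; apply: e.
Qed.

Lemma free_eval_dfwith (A : algebra O) (g : {linear V -> A}) n (v : 'I_n -> free_space) i x :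
  (fun j => free_eval g (dfwith v (i := i) x j))
    = dfwith (fun j => free_eval g (v j)) (i := i) (free_eval g x).
Proof. exact: (dfwith_map (fun _ => free_eval g)). Qed.

Definition free_alg : algebra O.
Proof.
refine (@Algebra K O free_space free_op _ _ _ _ _).
- move=> n a b x y; apply: free_eqP => A g.
  by rewrite free_eval_linear !free_eval_op (alg_op_linear _ b).
- move=> n x v i b y z; apply: free_eqP => A g.
  rewrite free_eval_linear !free_eval_op !free_eval_dfwith free_eval_linear.
  exact: (alg_op_multilinear x).
- by move=> a; apply: free_eqP => A g; rewrite free_eval_op alg_op_id.
- move=> n k x y a; apply: free_eqP => A g; rewrite !free_eval_op alg_op_comp.
  by congr alg_op; apply/funext => i; rewrite free_eval_op.
- move=> n s x a; apply: free_eqP => A g; rewrite !free_eval_op.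
  exact: (alg_op_perm s x).
Defined.

Definition free_gen (v : V) : free_alg := vq_pi (P := free_pres) (OVar v).

Lemma free_gen_linear : linear free_gen.
Proof.
move=> a x y; apply: free_eqP => A g.
by rewrite free_eval_linear !free_eval_pi /= linearP.
Qed.

Lemma free_algP (A : algebra O) (g : {linear V -> A}) :
  exists! f : alg_hom free_alg A, forall v, f (free_gen v) = g v.
Proof.
exists (@AlgHom K O free_alg A (mk_linear (free_eval_linear g)) (free_eval_op g)).
split=> [v|f fg]; first exact: free_eval_pi.
apply: alg_homP => a /=; rewrite -[a](vq_reprK a) free_eval_pi.
elim: (vq_repr a : oterm) => [v||t IHt u IHu|b t IHt|n x ts IH] /=.
- by rewrite -fg.
- by rewrite [RHS]linear0.
- by rewrite (vq_piD (P := free_pres)) [RHS]linearD IHt IHu.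
- by rewrite (vq_piZ (P := free_pres)) [RHS]linearZ IHt.
- have -> : vq_pi (P := free_pres) (OOp x ts)
      = alg_op (A := free_alg) x (fun i => vq_pi (P := free_pres) (ts i)).
    apply: free_eqP => B h; rewrite free_eval_op free_eval_pi /=.
    by congr alg_op; apply/funext => i; rewrite free_eval_pi.
  by rewrite hom_op; congr alg_op; apply/funext => i; apply: IH.
Qed.

End FreeAlgebra.

(* Stability in the last argument implies stability in every argument, by      *)
(* equivariance; see ideal_op.                                                 *)
Definition is_ideal (K : fieldType) (O : operad K) (B : algebra O) (I : set B) :=
  [/\ I 0, forall (a : K) x y, I x -> I y -> I (a *: x + y) &
      forall n (x : O n.+1) (b : 'I_n.+1 -> B), I (b ord_max) -> I (alg_op x b)].

Lemma smallest_is_ideal (K : fieldType) (O : operad K) (B : algebra O) (G : set B) :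
  is_ideal (smallest (@is_ideal K O B) G).
Proof.
split=> [J [[J0 _ _] _] //|a x y Ix Iy J JG|n x b Ib J JG].
  by case: (JG) => -[_ JD _] _; apply: JD; [apply: Ix|apply: Iy].
by case: (JG) => -[_ _ Jop] _; apply: Jop; apply: Ib.
Qed.

Section QuotientAlgebra.
Variables (K : fieldType) (O : operad K) (B : algebra O).
Variables (I : set B) (hI : is_ideal I).

Lemma ideal0 : I 0. Proof. by case: hI. Qed.
Lemma idealP a x y : I x -> I y -> I (a *: x + y).
Proof. by case: hI => _ + _; apply. Qed.
Lemma idealZ a x : I x -> I (a *: x).
Proof. by move=> Ix; rewrite -[_ *: _]addr0; apply: idealP ideal0. Qed.
Lemma idealD x y : I x -> I y -> I (x + y).
Proof. by move=> Ix Iy; rewrite -[x]scale1r; apply: idealP. Qed.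
Lemma idealN x : I x -> I (- x).
Proof. by move=> Ix; rewrite -scaleN1r; apply: idealZ. Qed.

Lemma ideal_op n (x : O n) (b : 'I_n -> B) i : I (b i) -> I (alg_op x b).
Proof.
case: n x b i => [x b []//|n x b i Ib].
pose c := fun l => b (tperm i ord_max l).
have -> : alg_op x b = alg_op (op_perm (tperm i ord_max) x) c.
  by rewrite alg_op_perm; congr alg_op; apply/funext => j; rewrite /c tpermK.
by case: hI => _ _; apply; rewrite /c tpermR.
Qed.

Lemma ideal_op_rel n (x : O n) (b b' : 'I_n -> B) :
  (forall i, I (b i - b' i)) -> I (alg_op x b - alg_op x b').
Proof.
move=> Ibb; pose m k : 'I_n -> B := fun i => if (i < k)%N then b' i else b i.
suff H k : (k <= n)%N -> I (alg_op x b - alg_op x (m k)).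
  have := H n (leqnn n); congr (I (_ - alg_op x _)).
  by apply/funext => i; rewrite /m ltn_ord.
elim: k => [_|k IH kn].
  by rewrite (_ : m 0 = b) ?subrr; [apply: ideal0|apply/funext].
rewrite -(subrKA (alg_op x (m k))); apply: idealD; first exact/IH/ltnW.
pose i := Ordinal kn.
have mE : m k = dfwith (m k) (i := i) (b i).
  apply/funext => j; case: dfwithP => [|//]; by rewrite /m ltnn.
have mSE : m k.+1 = dfwith (m k) (i := i) (b' i).
  apply/funext => j; case: dfwithP => [|j' ij]; first by rewrite /m ltnS leqnn.
  by rewrite /m ltnS leq_eqVlt [nat_of_ord j' == k](_ : _ = false) //;
     apply: contra_neqF ij => /eqP e; apply: val_inj.
have -> : alg_op x (m k) - alg_op x (m k.+1) = alg_op x (dfwith (m k) (i := i) (b i - b' i)).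
  rewrite {1}mE mSE; pose L := mk_linear (alg_op_multilinear x (m k) (i := i)).
  exact: (esym (linearB L _ _)).
by apply: (@ideal_op _ _ _ i); rewrite dfwith_in.
Qed.

Definition quot_pres : vect_pres K.
Proof.
refine (@VectPres K B (fun x y => I (x - y)) 0 -%R +%R *:%R
          _ _ _ _ _ _ _ _ _ _ _ _ _ _).
- by move=> x; rewrite subrr; apply: ideal0.
- by move=> x y /idealN /=; rewrite opprB.
- by move=> x y z xy yz /=; rewrite -(subrKA y); apply: idealD.
- by move=> x y /idealN /=; rewrite opprD.
- by move=> x x' y y' xx yy /=; rewrite opprD addrACA; apply: idealD.
- by move=> a x y xy /=; rewrite -scalerBr; apply: idealZ.
- by move=> x y z /=; rewrite addrA subrr; apply: ideal0.
- by move=> x y /=; rewrite [x + y]addrC subrr; apply: ideal0.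
- by move=> x /=; rewrite add0r subrr; apply: ideal0.
- by move=> x /=; rewrite addNr subrr; apply: ideal0.
- by move=> a b x /=; rewrite scalerA subrr; apply: ideal0.
- by move=> x /=; rewrite scale1r subrr; apply: ideal0.
- by move=> a x y /=; rewrite scalerDr subrr; apply: ideal0.
- by move=> a b x /=; rewrite scalerDl subrr; apply: ideal0.
Defined.

Definition quot_space : lmodType K := vquot quot_pres.

Definition quot_class (b : B) : quot_space := vq_pi (P := quot_pres) b.

Lemma quot_class_eqP b b' : quot_class b = quot_class b' <-> I (b - b').
Proof. exact: (vq_piE (P := quot_pres)). Qed.

Definition quot_op n (x : O n) (a : 'I_n -> quot_space) : quot_space :=
  quot_class (alg_op x (fun i => vq_repr (a i))).

Lemma quot_opE n (x : O n) (b : 'I_n -> B) :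
  quot_op x (fun i => quot_class (b i)) = quot_class (alg_op x b).
Proof.
apply/quot_class_eqP/ideal_op_rel => i.
exact: (vq_repr_pi (P := quot_pres) (b i)).
Qed.

Lemma quot_class_linear : linear quot_class.
Proof.
move=> a x y; rewrite /quot_class -(vq_piZ (P := quot_pres)).
by rewrite -(vq_piD (P := quot_pres)).
Qed.

Lemma quot_funK n (a : 'I_n -> quot_space) :
  a = (fun i => quot_class (vq_repr (a i))).
Proof. by apply/funext => i; rewrite /quot_class vq_reprK. Qed.

Lemma quot_dfwith n (v : 'I_n -> B) i x :
  dfwith (fun j => quot_class (v j)) (i := i) (quot_class x)
    = (fun j => quot_class (dfwith v (i := i) x j)).
Proof. by rewrite -(dfwith_map (fun _ => quot_class)). Qed.

Definition quot_alg : algebra O.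
Proof.
refine (@Algebra K O quot_space quot_op _ _ _ _ _).
- move=> n v a x y; rewrite (quot_funK v) !quot_opE -quot_class_linear.
  by congr quot_class; apply: (@alg_op_linear K O B n (fun i => vq_repr (v i))).
- move=> n x v i a y z.
  rewrite (quot_funK v) -(vq_reprK y) -(vq_reprK z).
  rewrite -[vq_pi (vq_repr y)]/(quot_class (vq_repr y)).
  rewrite -[vq_pi (vq_repr z)]/(quot_class (vq_repr z)).
  rewrite -quot_class_linear !quot_dfwith !quot_opE -quot_class_linear.
  by congr quot_class; apply: (alg_op_multilinear x).
- by move=> a; rewrite (quot_funK a) quot_opE alg_op_id.
- move=> n k x y a; rewrite (quot_funK a) quot_opE alg_op_comp -quot_opE.
  by congr quot_op; apply/funext => i; rewrite quot_opE.
- move=> n s x a; rewrite (quot_funK a) quot_opE alg_op_perm.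
  by rewrite -quot_opE.
Defined.

End QuotientAlgebra.

Record coalgebra (K : fieldType) := Coalgebra {
  coalg_space :> lmodType K;
  comul : {linear coalg_space -> tensor coalg_space coalg_space};
  counit : {linear coalg_space -> K^o};
  comulA : forall c,
    tlift (fun x y => tlift (fun u v => tens u (tens v y)) (comul x)) (comul c)
      = tlift (fun x y => tens x (comul y)) (comul c);
  counitl : forall c, tlift (fun x y => counit x *: y) (comul c) = c;
  counitr : forall c, tlift (fun x y => counit y *: x) (comul c) = c }.

Arguments comul {K C} : rename.
Arguments counit {K C} : rename.

Definition cocommutative (K : fieldType) (C : coalgebra K) : Prop :=
  forall c : C, tlift (fun x y => tens y x) (comul c) = comul c.

(* Insertion of x at position i of the tuple t. *)
Definition fins (T : Type) n (i : 'I_n.+1) (x : T) (t : 'I_n -> T) : 'I_n.+1 -> T :=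
  fun j => if unlift i j is Some k then t k else x.

(* A list of (n+1)-tuples (c_1, ..., c_{n+1}) representing the n-fold iterated *)
(* coproduct Delta^n(c) = sum c_1 (x) ... (x) c_{n+1}. It depends on the       *)
(* choice of representatives, but its sum under a multilinear map does not.    *)
Fixpoint sweedler (K : fieldType) (C : coalgebra K) n (c : C) :
    seq ('I_n.+1 -> C) :=
  match n with
  | 0 => [:: fun=> c]
  | m.+1 => [seq fins ord0 p.1 t
              | p <- vq_repr (comul c), t <- sweedler m p.2]
  end.

(* sum G(c_1, ..., c_n), where Delta^{-1} is the counit. *)
Definition sweedler_sum (K : fieldType) (C : coalgebra K) (W : lmodType K) n :
    (('I_n -> C) -> W) -> C -> W :=
  match n with
  | 0 => fun G c => (counit c : K) *: G (fun=> 0)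
  | m.+1 => fun G c => \sum_(t <- sweedler m c) G t
  end.

Section SweedlerTheory.
Variables (K : fieldType) (C : coalgebra K).
Implicit Types W Z : lmodType K.

Local Notation ml G := (multilinear (V := fun=> C : lmodType K) G).
Local Notation SS := sweedler_sum.

Lemma eq_SS W n (G H : ('I_n -> C) -> W) c :
  (forall t, G t = H t) -> SS G c = SS H c.
Proof. by move=> /funext ->. Qed.

Lemma SS0 W (G : ('I_0 -> C) -> W) c : SS G c = (counit c : K) *: G (fun=> 0).
Proof. by []. Qed.

Lemma SS1 W (G : ('I_1 -> C) -> W) c : SS G c = G (fun=> c).
Proof. by rewrite /= big_seq1. Qed.

Lemma SSSS W n (G : ('I_n.+2 -> C) -> W) c :
  SS G c = tlift (fun x y => SS (fun t => G (fins ord0 x t)) y) (comul c).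
Proof. by rewrite /= big_allpairs_dep. Qed.

Lemma SS_map W Z (L : {linear W -> Z}) n (G : ('I_n -> C) -> W) c :
  L (SS G c) = SS (fun t => L (G t)) c.
Proof. by case: n G => [|n] G /=; rewrite ?linearZ ?linear_sum. Qed.

Lemma SS_lincomb W a n (G H : ('I_n -> C) -> W) c :
  SS (fun t => a *: G t + H t) c = a *: SS G c + SS H c.
Proof.
case: n G H => [|n] G H /=; last by rewrite big_split /= scaler_sumr.
by rewrite scalerDr !scalerA mulrC.
Qed.

Lemma SS_sum W I (r : seq I) n (G : I -> ('I_n -> C) -> W) c :
  SS (fun t => \sum_(i <- r) G i t) c = \sum_(i <- r) SS (G i) c.
Proof.
case: n G => [|n] G /=; first by rewrite scaler_sumr.
exact: exchange_big.
Qed.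

Lemma SS_tlift W n (F : C -> C -> ('I_n -> C) -> W) t c :
  SS (fun u => tlift (fun x y => F x y u) t) c = tlift (fun x y => SS (F x y) c) t.
Proof. exact: (SS_sum _ (fun p : C * C => F p.1 p.2)). Qed.

Lemma fins_dfwith (T : Type) n (i : 'I_n.+1) (x : T) (t : 'I_n -> T) (k : 'I_n) (y : T) :
  fins i x (dfwith t (i := k) y) = dfwith (fins i x t) (i := lift i k) y.
Proof.
apply/funext => j; rewrite /fins; case: unliftP => [l ->|->].
  have [->|kl] := eqVneq k l; first by rewrite !dfwith_in.
  rewrite !dfwith_out ?liftK //; exact: contra_neq (@lift_inj _ i _ _) kl.
by rewrite dfwith_out ?unlift_none // eq_sym neq_lift.
Qed.

Lemma fins_x (B : lmodType K) n (i : 'I_n.+1) (x : B) (t : 'I_n -> B) :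
  fins i x t = dfwith (fins i 0 t) (i := i) x.
Proof.
apply/funext => j; rewrite /fins; case: unliftP => [l ->|->].
  by rewrite dfwith_out ?liftK // neq_lift.
by rewrite dfwith_in.
Qed.

Lemma ml_fins W (B : lmodType K) n (G : ('I_n.+1 -> B) -> W) i x :
  multilinear (V := fun=> B) G -> multilinear (V := fun=> B) (fun t => G (fins i x t)).
Proof. by move=> mG t k a y z /=; rewrite !fins_dfwith; apply: mG. Qed.

Lemma ml_fins_x W (B : lmodType K) n (G : ('I_n.+1 -> B) -> W) i t :
  multilinear (V := fun=> B) G -> linear (fun x => G (fins i x t)).
Proof. by move=> mG a y z; rewrite (fins_x i (a *: y + z)) (fins_x i y) (fins_x i z); apply: mG. Qed.

Lemma SS_linear W n (G : ('I_n -> C) -> W) : ml G -> linear (SS G).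
Proof.
elim: n G => [|[|n] IH] G mG a x y.
- by rewrite !SS0 linearP scalerDl scalerA.
- rewrite !SS1; have := mG (fun=> 0) ord0 a x y.
  have E z : dfwith (fun _ : 'I_1 => 0 : C) (i := ord0) z = fun=> z.
    by apply/funext => j; rewrite (ord1 j) dfwith_in.
  by rewrite !E.
- rewrite !SSSS linearP tlift_linear //; split=> [v b u u'|u].
    rewrite -SS_lincomb; apply: eq_SS => t; exact: ml_fins_x.
  exact/IH/ml_fins.
Qed.

Lemma SS_bilinear W n (G : C -> ('I_n -> C) -> W) :
  (forall x, ml (G x)) -> (forall t, linear (G^~ t)) ->
  bilinear (fun x y => SS (G x) y).
Proof.
move=> mG lG; split=> [v b u u'|u]; last exact: SS_linear.
by rewrite -SS_lincomb; apply: eq_SS => t; apply: lG.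
Qed.

Lemma SSS W n (G : ('I_n.+1 -> C) -> W) c : ml G ->
  SS G c = tlift (fun x y => SS (fun t => G (fins ord0 x t)) y) (comul c).
Proof.
case: n G => [|n] G mG; last exact: SSSS.
rewrite -{1}(counitr c).
have lG : linear (SS G) by exact: SS_linear.
rewrite (tlift_comp _ _ lG); apply: eq_tlift => x y; rewrite SS0.
rewrite (scalable_linear lG) SS1; congr (_ *: G _).
by apply/funext => j; rewrite (ord1 j) /fins unlift_none.
Qed.

Lemma comul_assoc W (F : C -> C -> C -> W) c :
  (forall y z, linear (fun x => F x y z)) ->
  (forall x z, linear (fun y => F x y z)) ->
  (forall x y, linear (fun z => F x y z)) ->
  tlift (fun x y => tlift (fun u v => F u v y) (comul x)) (comul c)
    = tlift (fun x y => tlift (fun u v => F x u v) (comul y)) (comul c).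
Proof.
move=> F1 F2 F3; pose L x t := tlift (F x) t.
have bF x : bilinear (F x) by split.
have bL : bilinear L.
  split=> [t a x y|x]; last exact: tlift_linear.
  by rewrite /L /= /tlift /tsum scaler_sumr -big_split; apply: eq_bigr => p _; apply: F1.
have lL := tlift_linear bL.
have := congr1 (tlift L) (comulA c); rewrite !(tlift_comp _ _ lL).
under eq_tlift do rewrite (tlift_comp _ _ lL).
under eq_tlift => x y.
  under eq_tlift => u v do rewrite tlift_tens // /L tlift_tens //.
  over.
move=> ->; apply: eq_tlift => x y; exact: tlift_tens.
Qed.

Lemma ml_reindex W n (s : 'I_n -> 'I_n) (G : ('I_n -> C) -> W) :
  injective s -> ml G -> ml (fun t => G (fun i => t (s i))).
Proof.
move=> sI mG t i a x y /=.
have E z : (fun j => dfwith t (i := i) z (s j))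
    = dfwith (fun j => t (s j)) (i := invF sI i) z.
  apply/funext => j; have [->|ij] := eqVneq j (invF sI i).
    by rewrite f_invF !dfwith_in.
  rewrite !dfwith_out //; first by rewrite eq_sym.
  by apply: contra_neq ij => ->; rewrite invF_f.
by rewrite !E; apply: mG.
Qed.

Lemma ml_cat W m n (Q : ('I_m -> C) -> ('I_n -> C) -> W) :
  (forall w, ml (fun u => Q u w)) -> (forall u, ml (Q u)) ->
  ml (fun w : 'I_(m + n) -> C => Q (fun i => w (lshift n i)) (fun i => w (rshift m i))).
Proof.
move=> mQl mQr t k a x y /=.
have inl_ z (i : 'I_m) : (fun j => dfwith t (i := lshift n i) z (lshift n j))
    = dfwith (fun j => t (lshift n j)) (i := i) z.
  apply/funext => j; have [->|ij] := eqVneq j i; first by rewrite !dfwith_in.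
  by rewrite !dfwith_out // 1?eq_sym // eq_lshift.
have inr_ z (i : 'I_m) : (fun j => dfwith t (i := lshift n i) z (rshift m j))
    = (fun j => t (rshift m j)).
  by apply/funext => j; rewrite dfwith_out // eq_lrshift.
have inl' z (i : 'I_n) : (fun j => dfwith t (i := rshift m i) z (rshift m j))
    = dfwith (fun j => t (rshift m j)) (i := i) z.
  apply/funext => j; have [->|ij] := eqVneq j i; first by rewrite !dfwith_in.
  by rewrite !dfwith_out // 1?eq_sym // eq_rshift.
have inr' z (i : 'I_n) : (fun j => dfwith t (i := rshift m i) z (lshift n j))
    = (fun j => t (lshift n j)).
  by apply/funext => j; rewrite dfwith_out // eq_rlshift.
rewrite -(splitK k); case: (split k) => i /=.
  by rewrite !inl_ !inr_; apply: mQl.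
by rewrite !inl' !inr'; apply: mQr.
Qed.

Lemma SS_cat W m n (Q : ('I_m -> C) -> ('I_n -> C) -> W) c :
  (forall w, ml (fun u => Q u w)) -> (forall u, ml (Q u)) ->
  SS (fun w : 'I_(m + n) -> C => Q (fun i => w (lshift n i)) (fun i => w (rshift m i))) c
    = tlift (fun x y => SS (fun w => SS (fun u => Q u w) x) y) (comul c).
Proof.
elim: m Q c => [|m IH] Q c mQl mQr.
  have lS : linear (SS (Q (fun=> 0))) by exact: SS_linear.
  rewrite -{1}(counitl c).
  have -> : SS (fun w : 'I_(0 + n) -> C => Q (fun i => w (lshift n i)) (fun i => w (rshift 0 i)))
     = SS (Q (fun=> 0)).
    apply/funext => d; apply: eq_SS => w; congr Q; apply/funext => i; first by case: i.
    by congr w; apply: val_inj.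
  rewrite (tlift_comp _ _ lS); apply: eq_tlift => x y.
  rewrite (scalable_linear lS).
  exact: (SS_map (mk_linear (linearPZ (GRing.scale (counit x : K) : {linear W -> W})))).
set G := (fun w : 'I_(m.+1 + n) -> C => _).
have insl (w : 'I_(m + n) -> C) x : (fun i => fins ord0 x w (@lshift m.+1 n i))
    = fins ord0 x (fun i => w (lshift n i)).
  apply/funext => i; rewrite /fins; case: (unliftP ord0 i) => [j ->|->].
    have -> : @lshift m.+1 n (lift ord0 j) = lift ord0 (lshift n j) by apply: val_inj.
    by rewrite liftK.
  have -> : @lshift m.+1 n ord0 = ord0 by apply: val_inj.
  by rewrite unlift_none.
have insr (w : 'I_(m + n) -> C) x : (fun i => fins ord0 x w (@rshift m.+1 n i))
    = (fun i => w (rshift m i)).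
  apply/funext => i; rewrite /fins.
  have -> : @rshift m.+1 n i = lift ord0 (rshift m i) by apply: val_inj.
  by rewrite liftK.
have mG : ml G by exact: ml_cat.
rewrite [LHS](SSS (n := m + n) c mG) /G.
under eq_tlift => x y.
  under eq_SS => t do rewrite insl insr.
  rewrite (IH (fun u w => Q (fins ord0 x u) w)); first last.
  - by move=> u; apply: mQr.
  - by move=> w; apply: (ml_fins (G := Q^~ w)).
  over.
rewrite -(comul_assoc (F := fun x y z => SS (fun w => SS (fun u => Q (fins ord0 x u) w) y) z)).
- apply: eq_tlift => x y; rewrite -SS_tlift; apply: eq_SS => w.
  by rewrite (SSS x (mQl w)).
- move=> y z a x x'; rewrite -SS_lincomb; apply: eq_SS => w.
  rewrite -SS_lincomb; apply: eq_SS => u; exact: (ml_fins_x (G := Q^~ w)).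
- move=> x z a y y'; rewrite -SS_lincomb; apply: eq_SS => w.
  exact/SS_linear/(ml_fins (G := Q^~ w)).
- move=> x y; apply: SS_linear => w i a u u' /=.
  by rewrite -SS_lincomb; apply: eq_SS => v; apply: mQr.
Qed.

Lemma fins_lift n (i : 'I_n.+1) (x y : C) (t : 'I_n -> C) :
  fins (lift ord0 i) x (fins ord0 y t) = fins ord0 y (fins i x t).
Proof.
apply/funext => j; rewrite {1 3}/fins; case: (unliftP ord0 j) => [j' ->|->].
  rewrite /fins; case: (unliftP i j') => [k ->|->].
    have -> : lift ord0 (lift i k) = lift (lift ord0 i) (lift ord0 k).
      by apply: val_inj; rewrite /= /bump /= !add1n ltnS; case: (i <= k)%N.
    by rewrite !liftK.
  by rewrite unlift_none.
case: unliftP => [k|/eqP]; last by rewrite -val_eqE.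
case: (unliftP ord0 k) => [k' ->|->]; last by rewrite /fins unlift_none.
by move=> /(congr1 val) /=; rewrite /bump; case: (_ <= _)%N.
Qed.

Hypothesis cC : cocommutative C.

Lemma comul_swap W (F : C -> C -> W) c : bilinear F ->
  tlift F (comul c) = tlift (fun x y => F y x) (comul c).
Proof.
move=> bF; have lF := tlift_linear bF.
rewrite -{1}(cC c) (tlift_comp _ _ lF).
by apply: eq_tlift => x y; rewrite tlift_tens.
Qed.

Lemma SS_ins W n (i : 'I_n.+1) (G : ('I_n.+1 -> C) -> W) c : ml G ->
  SS G c = tlift (fun x y => SS (fun t => G (fins i x t)) y) (comul c).
Proof.
elim: n i G c => [|n IH] i G c mG; first by rewrite (ord1 i); apply: SSS.
case: (unliftP ord0 i) => [i' ->|->]; last exact: SSS.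
rewrite SSS //.
under eq_tlift => x y do rewrite (IH i' _ _ (ml_fins ord0 x mG)).
under [RHS]eq_tlift => x y.
  rewrite SSS; last exact: ml_fins.
  under eq_tlift => u v do under eq_SS => t do rewrite fins_lift.
  over.
pose F x u v := SS (fun t => G (fins ord0 x (fins i' u t))) v.
have F1 u v : linear (fun x => F x u v).
  by move=> a x x'; rewrite -SS_lincomb; apply: eq_SS => t; apply: ml_fins_x.
have F2 x v : linear (fun u => F x u v).
  move=> a u u'; rewrite -SS_lincomb; apply: eq_SS => t.
  exact: (ml_fins_x (G := fun w => G (fins ord0 x w)) i' t (ml_fins ord0 x mG)).
have F3 x u : linear (fun v => F x u v).
  exact/SS_linear/(ml_fins (G := fun w => G (fins ord0 x w)) i' u (ml_fins ord0 x mG)).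
rewrite -[LHS](comul_assoc (F := F)) //.
rewrite -[RHS](comul_assoc (F := fun x u v => F u x v)) //.
by apply: eq_tlift => x y; apply: comul_swap; split.
Qed.

Lemma SS_inj W n (s : 'I_n -> 'I_n) (G : ('I_n -> C) -> W) c :
  injective s -> ml G -> SS (fun t => G (fun i => t (s i))) c = SS G c.
Proof.
elim: n s G c => [|n IH] s G c sI mG.
  by rewrite !SS0; congr (_ *: G _); apply/funext; case.
pose i := invF sI ord0; have si : s i = ord0 by rewrite f_invF.
pose s' k : 'I_n := odflt k (unlift ord0 (s (lift i k))).
have s'E k : s (lift i k) = lift ord0 (s' k).
  rewrite /s'; case: unliftP => [//|]; rewrite -si => /sI /eqP.
  by rewrite eq_sym (negPf (neq_lift _ _)).
have s'I : injective s'.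
  by move=> k l e; apply/(@lift_inj _ i)/sI; rewrite !s'E e.
have E x t : (fun j => fins ord0 x t (s j)) = fins i x (fun k => t (s' k)).
  apply/funext => j; rewrite {2}/fins; case: (unliftP i j) => [k ->|->].
    by rewrite s'E /fins liftK.
  by rewrite si /fins unlift_none.
rewrite SSS; last exact: ml_reindex.
rewrite (SS_ins i) //; apply: eq_tlift => x y.
under eq_SS => t do rewrite E.
exact: (IH s' (fun t => G (fins i x t)) y s'I (ml_fins i x mG)).
Qed.

Lemma ml_comp W (B : lmodType K) n (k : 'I_n -> nat) N (r : {i : 'I_n & 'I_(k i)} -> 'I_N)
    (g : ('I_n -> B) -> W) (H : forall i, ('I_(k i) -> C) -> B) :
  bijective r -> multilinear (V := fun=> B) g -> (forall i, ml (H i)) ->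
  ml (fun w => g (fun i => H i (fun j => w (r (Tagged (fun i => 'I_(k i)) j))))).
Proof.
move=> [q rK qK] mg mH w p a x y /=; rewrite -(qK p); case: (q p) => i j.
have E z i' : (fun j' => dfwith w (i := r (Tagged _ j)) z
      (r (Tagged (fun i => 'I_(k i)) (j' : 'I_(k i')))))
    = dfwith (T := fun i => 'I_(k i) -> C)
        (fun i j' => w (r (Tagged (fun i => 'I_(k i)) j'))) (i := i)
        (dfwith (fun j' => w (r (Tagged (fun i => 'I_(k i)) j'))) (i := j) z) i'.
  apply/funext => j'; have [e|ii] := eqVneq i i'.
    subst i'; rewrite dfwith_in; have [->|jj] := eqVneq j j'; first by rewrite !dfwith_in.
    rewrite !dfwith_out // (inj_eq (can_inj rK)); apply: contra_neq jj => e.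
    exact: eq_from_Tagged e.
  rewrite !dfwith_out // (inj_eq (can_inj rK)).
  by apply: contra_neq ii => /(congr1 tag).
pose v i' := H i' (fun j' => w (r (Tagged (fun i => 'I_(k i)) j'))).
have E' z : (fun i' => H i' (fun j' => dfwith w (i := r (Tagged _ j)) z
      (r (Tagged (fun i => 'I_(k i)) j'))))
    = dfwith v (i := i) (H i (dfwith (fun j' => w (r (Tagged (fun i => 'I_(k i)) j'))) (i := j) z)).
  by apply/funext => i'; rewrite E; apply: (congr1 (fun f : 'I_n -> B => f i') (dfwith_map H _ _)).
by rewrite !E' mH mg.
Qed.

Lemma SS_comp W (B : lmodType K) n (k : 'I_n -> nat) N (r : {i : 'I_n & 'I_(k i)} -> 'I_N)
    (g : ('I_n -> B) -> W) (H : forall i, ('I_(k i) -> C) -> B) c :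
  bijective r -> multilinear (V := fun=> B) g -> (forall i, ml (H i)) ->
  SS (fun t => g (fun i => SS (H i) (t i))) c
    = SS (fun w => g (fun i => H i (fun j => w (r (Tagged (fun i => 'I_(k i)) j))))) c.
Proof.
elim: n k N r g H c => [|n IH] k N r g H c br mg mH.
  have : #|{: 'I_N}| = #|{: {i : 'I_0 & 'I_(k i)}}| by rewrite (bij_eq_card br).
  rewrite card_ord eq_card0 => [N0|[[]//]]; subst N; rewrite !SS0.
  by congr (_ *: g _); apply/funext; case.
pose k' i := k (lift ord0 i).
have NE : N = (k ord0 + \sum_i k' i)%N.
  have : #|{: 'I_N}| = #|{: {i : 'I_n.+1 & 'I_(k i)}}| by rewrite (bij_eq_card br).
  by rewrite card_ord tagnat.card big_ord_recl.
subst N.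
pose s (u : 'I_(k ord0 + \sum_i k' i)) := match split u with
  | inl j => r (Tagged (fun i => 'I_(k i)) j)
  | inr v => r (Tagged (fun i => 'I_(k i)) (i := lift ord0 (tag (tagnat.sig v)))
                  (tagged (tagnat.sig v)))
  end.
have sI : injective s.
  move=> u v; rewrite -(splitK u) -(splitK v) /s !unsplitK.
  case: (split u) => j; case: (split v) => j' /(bij_inj br) e.
  - by rewrite (eq_from_Tagged e).
  - by move: (congr1 tag e).
  - by move: (congr1 tag e).
  congr unsplit; congr inr; apply: (@tagnat.sig_inj _ k').
  case: (tagnat.sig j) (tagnat.sig j') e => [i l] [i' l'] /= e.
  have ii : i = i' by apply: (@lift_inj _ ord0); move: (congr1 tag e).
  by subst i'; rewrite (eq_from_Tagged e).
pose Q u w := g (fins ord0 (H ord0 u)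
  (fun i => H (lift ord0 i) (fun j : 'I_(k' i) => w (tagnat.Rank i j)))).
have mQl w : ml (fun u => Q u w).
  by move=> u i a x y; rewrite /Q /= mH; apply: (ml_fins_x ord0 _ mg).
have mQr u : ml (Q u).
  exact: (@ml_comp W B n k' _ (@tagnat.rank _ k') (fun t => g (fins ord0 (H ord0 u) t))
    (fun i => H (lift ord0 i)) (@tagnat.rank_bij _ k') (ml_fins _ _ mg) (fun i => mH _)).
transitivity (SS (fun w : 'I_(k ord0 + \sum_i k' i) -> C =>
    Q (fun i => w (lshift _ i)) (fun i => w (rshift _ i))) c); last first.
  rewrite -(SS_inj c sI (ml_cat mQl mQr)); apply: eq_SS => w; congr g.
  apply/funext => i; rewrite /fins; case: unliftP => [i' ->|->]; congr H.
    apply/funext => j; rewrite /s -[rshift _ _]/(unsplit (inr _)) unsplitK.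
    by rewrite tagnat.rankK.
  by apply/funext => j; rewrite /s -[lshift _ _]/(unsplit (inl _)) unsplitK.
rewrite SS_cat // SSS; last first.
  move=> t i a x y /=; rewrite !(dfwith_map (fun i => SS (H i))).
  by rewrite SS_linear // mg.
apply: eq_tlift => x y.
have E t : (fun i => SS (H i) (fins ord0 x t i))
    = fins ord0 (SS (H ord0) x) (fun i => SS (H (lift ord0 i)) (t i)).
  by apply/funext => i; rewrite /fins; case: unliftP => [i' ->|->].
under eq_SS => t do rewrite E.
rewrite (IH k' _ (@tagnat.rank _ k') (fun t => g (fins ord0 (SS (H ord0) x) t))
  (fun i => H (lift ord0 i)) y (@tagnat.rank_bij _ k') (ml_fins _ _ mg) (fun i => mH _)).
apply: eq_SS => w.
exact: (SS_map (mk_linear (ml_fins_x ord0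
  (fun i => H (lift ord0 i) (fun j : 'I_(k' i) => w (tagnat.Rank i j))) mg))).
Qed.

End SweedlerTheory.

Section Convolution.
Variables (K : fieldType) (O : operad K) (C : coalgebra K).

Lemma conv_multilinear (B : algebra O) n (x : O n) (f : 'I_n -> linhom C B) :
  multilinear (V := fun=> C : lmodType K) (fun t => alg_op x (fun i => f i (t i))).
Proof.
move=> t i a c d; rewrite !(dfwith_map (fun j => f j)) linearP.
exact: (alg_op_multilinear x).
Qed.

Definition conv_op (B : algebra O) n (x : O n) (f : 'I_n -> linhom C B) :
    linhom C B :=
  mk_linear (SS_linear (conv_multilinear x f)).

Lemma conv_opE (B : algebra O) n (x : O n) (f : 'I_n -> linhom C B) c :
  conv_op x f c = sweedler_sum (fun t => alg_op x (fun i => f i (t i))) c.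
Proof. by []. Qed.

Hypothesis cC : cocommutative C.

Definition conv_alg (B : algebra O) : algebra O.
Proof.
refine (@Algebra K O (linhom C B) (@conv_op B) _ _ _ _ _).
- move=> n f a x y; apply: linear_funP => c; rewrite lh_lincomb !conv_opE.
  by rewrite -SS_lincomb; apply: eq_SS => t; apply: (@alg_op_linear K O B n).
- move=> n x f i a g h; apply: linear_funP => c; rewrite lh_lincomb !conv_opE.
  rewrite -SS_lincomb; apply: eq_SS => t.
  rewrite !(dfwith_map (fun j (l : linhom C B) => l (t j))).
  exact: (alg_op_multilinear x).
- by move=> f; apply: linear_funP => c; rewrite conv_opE SS1 alg_op_id.
- move=> n k x y f; apply: linear_funP => c; rewrite !conv_opE.
  rewrite (SS_comp cC (H := fun i u => alg_op (y i)
      (fun j => f (tagnat.Rank i j) (u j))) c (@tagnat.rank_bij _ k)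
      (alg_op_multilinear x) (fun i => conv_multilinear (y i) _)).
  by apply: eq_SS => w; rewrite alg_op_comp.
- move=> n s x f; apply: linear_funP => c; rewrite !conv_opE.
  rewrite -(SS_inj cC c (@perm_inj _ s) (conv_multilinear x (fun i => f (s i)))).
  by apply: eq_SS => t; rewrite alg_op_perm.
Defined.

Section ConvolutionMap.
Variables (B B' : algebra O) (h : alg_hom B B').

Definition conv_comp (f : linhom C B) : linhom C B' :=
  mk_linear (linearPZ (h \o f : {linear C -> B'})).

Lemma conv_comp_linear : linear conv_comp.
Proof. by move=> a f g; apply: linear_funP => c; apply: linearP. Qed.

Lemma conv_comp_op n (x : O n) (f : 'I_n -> linhom C B) :
  conv_comp (conv_op x f) = conv_op x (fun i => conv_comp (f i)).
Proof.
apply: linear_funP => c; rewrite [LHS](SS_map h).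
by apply: eq_SS => t; rewrite hom_op.
Qed.

Definition conv_map : alg_hom (conv_alg B) (conv_alg B') :=
  @AlgHom K O (conv_alg B) (conv_alg B') (mk_linear conv_comp_linear) conv_comp_op.

End ConvolutionMap.

End Convolution.

Section Sweedler.
Variables (K : fieldType) (O : operad K) (C : coalgebra K).

Definition is_measuring (A B : algebra O) (phi : {linear C -> linhom A B}) : Prop :=
  (forall n (x : O n.+1) (a : 'I_n.+1 -> A) (c : C),
     phi c (alg_op x a)
       = \sum_(t <- sweedler n c) alg_op x (fun i => phi (t i) (a i)))
  /\ (forall (x : O 0) (c : C),
     phi c (alg_unit A x) = (counit c : K) *: alg_unit B x).

Variable A : algebra O.

Let F : algebra O := free_alg O (tensor C A).
Let gen (c : C) (a : A) : F := free_gen O (tens c a).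

Variant sweedler_rel : set F :=
| SweedlerUnit (c : C) (x : O 0) :
    sweedler_rel (gen c (alg_unit A x) - (counit c : K) *: alg_unit F x)
| SweedlerOp (c : C) n (x : O n.+1) (a : 'I_n.+1 -> A) :
    sweedler_rel (gen c (alg_op x a)
      - \sum_(t <- sweedler n c) alg_op x (fun i => gen (t i) (a i))).

Definition sweedler_ideal : set F := smallest (@is_ideal K O F) sweedler_rel.

Definition sweedler_prod : algebra O :=
  quot_alg (smallest_is_ideal sweedler_rel : is_ideal sweedler_ideal).

(* The class of c |> a. *)
Definition sweedler_gen (c : C) (a : A) : sweedler_prod :=
  quot_class (smallest_is_ideal sweedler_rel) (gen c a).

Lemma sweedler_gen_bilinear : bilinear sweedler_gen.
Proof.
split=> [a b c d|c b a a']; rewrite /sweedler_gen -quot_class_linear.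
  by rewrite /gen (tens_bilinear C A).1 free_gen_linear.
by rewrite /gen (tens_bilinear C A).2 free_gen_linear.
Qed.

Definition sweedler_act (c : C) : linhom A sweedler_prod :=
  mk_linear (sweedler_gen_bilinear.2 c).

Lemma sweedler_act_linear : linear sweedler_act.
Proof.
by move=> a c d; apply: linear_funP => x; apply: (sweedler_gen_bilinear.1 x).
Qed.

Definition sweedler_phi : {linear C -> linhom A sweedler_prod} :=
  mk_linear sweedler_act_linear.

Lemma sweedler_phiE c a : sweedler_phi c a = sweedler_gen c a.
Proof. by []. Qed.

End Sweedler.

Arguments sweedler_prod {K O} C A.
Arguments sweedler_phi {K O} C A.

(* Main.v *)
Require Import Defs.
From mathcomp Require Import all_boot all_order all_fingroup all_algebra.
From mathcomp Require Import boolp classical_sets.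

Set Implicit Arguments.
Unset Strict Implicit.
Unset Printing Implicit Defensive.

Import GRing.Theory.
Local Open Scope ring_scope.

(** The product C |> A is presented by generators and relations, and the
    relations say exactly that the generators c |> a form a measuring.

    Existence in (a). A measuring phi is bilinear in (c, a), so it extends to
    an algebra morphism from the free algebra on C (x) A to B. The kernel of
    that morphism is an ideal, and it contains the defining relations because
    phi is a measuring; hence it contains the smallest ideal generated by them,
    and the morphism descends to C |> A (sweedler_lift_exists).
    Uniqueness in (a): C |> A is generated as an algebra by the classes of the
    c |> a, so a morphism is determined by its values on them
    (sweedler_hom_ext).

    For (b), exchanging the arguments turns a linear map C -> Hom(A, B) into a
    linear map A -> Hom(C, B). The measuring condition on the former is, word
    for word, the condition that the latter be an algebra morphism to the
    convolution algebra [C, B] (measuring_flip_op). By (a), algebra morphisms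
    C |> A -> B correspond to measurings, hence to algebra morphisms
    A -> [C, B]. The functor C |> - is the one obtained from (a) by
    restricting a measuring along g : A -> A', and both naturality squares
    then hold on the generators by inspection. *)

(** * Linear maps *)

Section LinearMaps.
Variable K : fieldType.

Lemma tensor_linear_ext (V W Z : lmodType K) (f g : {linear tensor V W -> Z}) :
  (forall x y, f (tens x y) = g (tens x y)) -> f =1 g.
Proof.
move=> fg t; rewrite -(tlift_id t).
rewrite (tlift_comp _ _ (linearPZ f)) (tlift_comp _ _ (linearPZ g)).
exact: eq_tlift.
Qed.

Lemma linhom_bilinear (V W Z : lmodType K) (phi : {linear V -> linhom W Z}) :
  bilinear_for *:%R *:%R (fun x y => phi x y).
Proof. by split=> [y a u v|x a u v]; rewrite linearP. Qed.

Lemma lin_comp_linear (V W W' Z Z' : lmodType K) (phi : {linear V -> linhom W Z})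
    (g : {linear W' -> W}) (h : {linear Z -> Z'}) x :
  linear (fun y => h (phi x (g y))).
Proof. by move=> a u v; rewrite !linearP. Qed.

Definition lin_comp_at (V W W' Z Z' : lmodType K) (phi : {linear V -> linhom W Z})
    (g : {linear W' -> W}) (h : {linear Z -> Z'}) (x : V) : linhom W' Z' :=
  mk_linear (lin_comp_linear phi g h x).

Lemma lin_comp_at_linear (V W W' Z Z' : lmodType K) (phi : {linear V -> linhom W Z})
    (g : {linear W' -> W}) (h : {linear Z -> Z'}) : linear (lin_comp_at phi g h).
Proof.
move=> a u v; apply: linear_funP => y.
by rewrite lh_lincomb /= linearP lh_lincomb linearP.
Qed.

(** For phi : C -> Hom(A, B), this is Hom(g, h) o phi : C -> Hom(A', B'). *)
Definition lin_comp (V W W' Z Z' : lmodType K) (phi : {linear V -> linhom W Z})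
    (g : {linear W' -> W}) (h : {linear Z -> Z'}) : {linear V -> linhom W' Z'} :=
  mk_linear (lin_comp_at_linear phi g h).

Definition lin_flip_at (V W Z : lmodType K) (phi : {linear V -> linhom W Z})
    (y : W) : linhom V Z :=
  mk_linear ((linhom_bilinear phi).1 y).

Lemma lin_flip_at_linear (V W Z : lmodType K) (phi : {linear V -> linhom W Z}) :
  linear (lin_flip_at phi).
Proof. by move=> a u v; apply: linear_funP => x; rewrite lh_lincomb /= linearP. Qed.

Definition lin_flip (V W Z : lmodType K) (phi : {linear V -> linhom W Z}) :
    {linear W -> linhom V Z} :=
  mk_linear (lin_flip_at_linear phi).

End LinearMaps.

(** * Kernels and quotient algebras *)

Section Ideals.
Variables (K : fieldType) (O : operad K).

Definition alg_id (A : algebra O) : alg_hom A A :=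
  @AlgHom K O A A idfun (fun _ _ _ => erefl).

(** An operation vanishes as soon as one of its arguments does, being linear
    in that argument. *)
Lemma kernel_is_ideal (B D : algebra O) (f : alg_hom B D) :
  is_ideal [set b | f b = 0]%classic.
Proof.
split=> [|a x y /= fx fy|n x b /= fb]; first exact: linear0.
  by rewrite linearP fx fy scaler0 addr0.
rewrite hom_op.
have -> : (fun i => f (b i)) = dfwith (fun i => f (b i)) (i := ord_max) (0 : D).
  by apply/funext => i; case: dfwithP.
exact: (linear0 (mk_linear (alg_op_multilinear x (fun i => f (b i)) (i := ord_max)))).
Qed.

Section Quotient.
Variables (B : algebra O) (I : set B) (hI : is_ideal I).

Definition quot_hom : alg_hom B (quot_alg hI) :=
  @AlgHom K O B (quot_alg hI) (mk_linear (quot_class_linear hI))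
    (fun n x b => esym (quot_opE hI x b)).

Variables (D : algebra O) (f : alg_hom B D).
Hypothesis If0 : forall b, I b -> f b = 0.

Definition quot_lift_fun (y : quot_alg hI) : D := f (vq_repr y).

Lemma quot_lift_funE b : quot_lift_fun (quot_hom b) = f b.
Proof.
apply/eqP; rewrite -subr_eq0 -linearB; apply/eqP/If0.
exact: (vq_repr_pi (P := quot_pres hI) b).
Qed.

Lemma quot_hom_surj (y : quot_alg hI) : y = quot_hom (vq_repr y).
Proof. by rewrite /= /quot_class vq_reprK. Qed.

Lemma quot_lift_linear : linear quot_lift_fun.
Proof.
move=> a y z; rewrite (quot_hom_surj y) (quot_hom_surj z) -linearP.
by rewrite !quot_lift_funE linearP.
Qed.

Lemma quot_lift_op n (x : O n) (y : 'I_n -> quot_alg hI) :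
  quot_lift_fun (alg_op x y) = alg_op x (fun i => quot_lift_fun (y i)).
Proof.
have -> : y = (fun i => quot_hom (vq_repr (y i))) by exact: quot_funK.
rewrite -hom_op quot_lift_funE hom_op.
by congr alg_op; apply/funext => i; rewrite quot_lift_funE.
Qed.

Definition quot_lift : alg_hom (quot_alg hI) D :=
  @AlgHom K O (quot_alg hI) D (mk_linear quot_lift_linear) quot_lift_op.

Lemma quot_liftE b : quot_lift (quot_hom b) = f b.
Proof. exact: quot_lift_funE. Qed.

End Quotient.

End Ideals.

(** * Measurings and the universal property *)

Section Measurings.
Variables (K : fieldType) (O : operad K) (C : coalgebra K).

(** With the convention that Delta^{-1} is the counit, the nullary and the
    positive-arity conditions become one equation, which has the same shape as
    the operations of the convolution algebra. *)
Lemma measuringP (A B : algebra O) (phi : {linear C -> linhom A B}) :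
  is_measuring phi <->
  forall n (x : O n) (a : 'I_n -> A) (c : C),
    phi c (alg_op x a)
      = sweedler_sum (fun t => alg_op x (fun i => phi (t i) (a i))) c.
Proof.
split=> [[phiS phi0] [|n] x a c|phiE].
- have <- : (fun=> 0) = a by apply/funext; case.
  rewrite SS0 [LHS]phi0; congr (_ *: alg_op x _); by apply/funext; case.
- exact: phiS.
split=> [n x a c|x c]; first exact: phiE.
rewrite [LHS]phiE SS0; congr (_ *: alg_op x _); by apply/funext; case.
Qed.

(** Used with h the identity to make C |> - a functor, and with g the identity
    to turn a morphism out of C |> A into a measuring. *)
Lemma measuring_comp (A A' B B' : algebra O) (phi : {linear C -> linhom A B})
    (g : alg_hom A' A) (h : alg_hom B B') :
  is_measuring phi -> is_measuring (lin_comp phi g h).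
Proof.
move=> /measuringP phiE; apply/measuringP => n x a c /=.
rewrite hom_op phiE SS_map; apply: eq_SS => t; exact: hom_op.
Qed.

Section Universal.
Variable A : algebra O.

(** The two families of generating relations of the ideal are precisely the
    two measuring conditions for c |> a. *)
Lemma sweedler_phi_measuring : is_measuring (sweedler_phi C A).
Proof.
pose hJ := smallest_is_ideal (@sweedler_rel K O C A).
have relE b b' : sweedler_rel (b - b') -> quot_hom hJ b = quot_hom hJ b'.
  by move=> r; apply/quot_class_eqP => J [_]; apply.
split=> [n x a c|x c].
  transitivity (quot_hom hJ (\sum_(t <- sweedler n c)
      alg_op x (fun i => free_gen O (tens (t i) (a i))))).
    exact/relE/SweedlerOp.
  rewrite linear_sum; apply: eq_bigr => t _; exact: hom_op.
transitivity (quot_hom hJ ((counit c : K) *: alg_unit (free_alg O (tensor C A)) x)).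
  exact/relE/SweedlerUnit.
rewrite linearZ hom_op; congr (_ *: alg_op x _); by apply/funext; case.
Qed.

(** The quotient map is surjective, the free algebra is generated by C (x) A,
    and C (x) A is spanned by pure tensors. *)
Lemma sweedler_hom_ext (B : algebra O) (f g : alg_hom (sweedler_prod C A) B) :
  (forall c a, f (sweedler_phi C A c a) = g (sweedler_phi C A c a)) -> f = g.
Proof.
move=> fg; pose q := quot_hom (smallest_is_ideal (@sweedler_rel K O C A)).
have lq : linear (fun t => f (q (free_gen O t))).
  by move=> a s t; rewrite free_gen_linear !linearP.
have [k [_ kU]] := free_algP (mk_linear lq).
have fgq : hom_comp f q = hom_comp g q.
  rewrite -(kU (hom_comp f q)) //; apply: kU => t /=.
  have lq' : linear (fun t => g (q (free_gen O t))).
    by move=> a s t'; rewrite free_gen_linear !linearP.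
  apply: (tensor_linear_ext (f := mk_linear lq') (g := mk_linear lq)) => c a.
  exact/esym/fg.
apply: alg_homP => y; rewrite (quot_hom_surj y).
exact: (congr1 (fun h : alg_hom _ B => h (vq_repr y)) fgq).
Qed.

(** The morphism induced by phi on the free algebra kills the relations since
    phi is a measuring, and its kernel is an ideal, so it kills the ideal that
    they generate. *)
Lemma sweedler_lift_exists (B : algebra O) (phi : {linear C -> linhom A B}) :
  is_measuring phi ->
  exists f : alg_hom (sweedler_prod C A) B,
    forall c a, f (sweedler_phi C A c a) = phi c a.
Proof.
move=> [phiS phi0]; have bphi := linhom_bilinear phi.
have [k [kE _]] := free_algP (mk_linear (tlift_linear bphi)).
have genE c a : k (free_gen O (tens c a)) = phi c a.
  by rewrite kE mk_linearE tlift_tens.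
have k0 b : sweedler_ideal b -> k b = 0.
  move=> /(_ [set b | k b = 0]%classic); apply; split; first exact: kernel_is_ideal.
  move=> _ [c x|c n x a] /=; apply/eqP; rewrite linearB subr_eq0; apply/eqP.
    rewrite genE [LHS]phi0 linearZ hom_op; congr (_ *: alg_op x _).
    by apply/funext; case.
  rewrite genE phiS linear_sum; apply: eq_bigr => t _.
  by rewrite hom_op; congr alg_op; apply/funext => i; rewrite genE.
exists (quot_lift (smallest_is_ideal (@sweedler_rel K O C A)) k0) => c a.
by rewrite [LHS]quot_liftE genE.
Qed.

End Universal.

(** * The adjunction with the convolution algebra *)

Section Adjunction.
Variable cC : cocommutative C.

(** Evaluated at c, the right-hand side is by definition the Sweedler sum of
    measuringP. *)
Lemma measuring_flip_op (A B : algebra O) (phi : {linear C -> linhom A B}) :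
  is_measuring phi <->
  forall n (x : O n) (a : 'I_n -> A),
    lin_flip phi (alg_op x a)
      = alg_op (A := conv_alg cC B) x (fun i => lin_flip phi (a i)).
Proof.
split=> [/measuringP phiE n x a|phiE]; first exact/linear_funP/phiE.
by apply/measuringP => n x a c; exact: (congr1 (fun l : linhom C B => l c) (phiE n x a)).
Qed.

Definition conv_hom (A B : algebra O) (f : alg_hom (sweedler_prod C A) B) :
    alg_hom A (conv_alg cC B).
Proof.
refine (@AlgHom K O A (conv_alg cC B)
  (lin_flip (lin_comp (sweedler_phi C A) (alg_id A) f)) _).
exact/measuring_flip_op/measuring_comp/sweedler_phi_measuring.
Defined.

Lemma conv_homE (A B : algebra O) (f : alg_hom (sweedler_prod C A) B) a c :
  (conv_hom f a : linhom C B) c = f (sweedler_phi C A c a).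
Proof. by []. Qed.

Lemma conv_hom_inj (A B : algebra O) : injective (@conv_hom A B).
Proof.
move=> f g fg; apply: sweedler_hom_ext => c a.
by rewrite -!conv_homE fg.
Qed.

Lemma conv_hom_surj (A B : algebra O) (h : alg_hom A (conv_alg cC B)) :
  exists f, conv_hom f = h.
Proof.
pose phi := lin_flip (h : {linear A -> linhom C B}).
have mphi : is_measuring phi.
  apply/measuring_flip_op => n x a; apply: linear_funP => c /=.
  by rewrite hom_op.
have [f fE] := sweedler_lift_exists mphi; exists f.
by apply: alg_homP => a; apply: linear_funP => c; rewrite -[RHS](fE c a).
Qed.

Lemma conv_hom_bij (A B : algebra O) : bijective (@conv_hom A B).
Proof.
have [inv invE] := choice (@conv_hom_surj A B).
exists inv => // f; exact/conv_hom_inj/invE.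
Qed.

End Adjunction.

End Measurings.

Theorem theorem1p7 (K : fieldType) (O : operad K) (C : coalgebra K) :
  (forall A : algebra O,
     is_measuring (sweedler_phi C A)
     /\ forall (B : algebra O) (phi' : {linear C -> linhom A B}),
          is_measuring phi' ->
          exists! f : alg_hom (sweedler_prod C A) B,
            forall (c : C) (a : A), phi' c a = f (sweedler_phi C A c a))
  /\
  (forall cC : cocommutative C,
     exists prod_map : forall A A' : algebra O,
         alg_hom A A' -> alg_hom (sweedler_prod C A) (sweedler_prod C A'),
       (forall (A A' : algebra O) (g : alg_hom A A') (c : C) (a : A),
          prod_map A A' g (sweedler_phi C A c a) = sweedler_phi C A' c (g a))
       /\
       exists Phi : forall A B : algebra O,
           alg_hom (sweedler_prod C A) B -> alg_hom A (conv_alg cC B),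
         (forall A B : algebra O, bijective (Phi A B))
         /\ (forall (A A' B : algebra O) (g : alg_hom A A')
               (f : alg_hom (sweedler_prod C A') B),
               Phi A B (hom_comp f (prod_map A A' g)) = hom_comp (Phi A' B f) g)
         /\ (forall (A B B' : algebra O) (h : alg_hom B B')
               (f : alg_hom (sweedler_prod C A) B),
               Phi A B' (hom_comp h f) = hom_comp (conv_map cC h) (Phi A B f))).
Proof.
split=> [A|cC].
  split=> [|B phi' mphi']; first exact: sweedler_phi_measuring.
  have [f fE] := sweedler_lift_exists mphi'.
  exists f; split=> [c a|g gE]; first by rewrite fE.
  by apply: sweedler_hom_ext => c a; rewrite fE gE.
have map_exists (A A' : algebra O) (g : alg_hom A A') :
    exists g' : alg_hom (sweedler_prod C A) (sweedler_prod C A'),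
      forall c a, g' (sweedler_phi C A c a) = sweedler_phi C A' c (g a).
  exact: sweedler_lift_exists
    (measuring_comp g (alg_id _) (sweedler_phi_measuring C A')).
pose prod_map A A' g := projT1 (cid (map_exists A A' g)).
have prod_mapE A A' g c a :
    prod_map A A' g (sweedler_phi C A c a) = sweedler_phi C A' c (g a).
  exact: (projT2 (cid (map_exists A A' g))).
exists prod_map; split=> //.
exists (@conv_hom K O C cC); split; first exact: conv_hom_bij.
split=> [A A' B g f|A B B' h f]; apply: alg_homP => a; apply: linear_funP => c //.
exact: (congr1 f (prod_mapE A A' g c a)).
Qed.
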